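(* Let $k\ge2$ and $d\ge k-1$. Balls of positive radii $a_1,\ldots,a_k$ pack in a ball of radius $R$ in $\mathbb R^d$ if and only if they pack in a ball of the same radius $R$ in $\mathbb R^{k-1}$. A single ball fits in a ball of radius $R$ if and only if its radius is at most $R$, in every positive dimension.
   Context: Balls of radii $a_1,\dots,a_k$ ''pack'' in a ball of radius $R$ in $\mathbb R^d$ if closed $d$-dimensional balls with these radii can be positioned inside a closed $d$-dimensional ball of radius $R$ with pairwise disjoint interiors; equivalently there are centers $c_i\in\mathbb R^d$ with $a_i\le R$, $\|c_i\|\le R-a_i$ and $\|c_i-c_j\|\ge a_i+a_j$ for $i\ne j$. *)

(* Defs.v *)
From mathcomp Require Import all_boot all_order all_algebra.
From mathcomp Require Import all_classical all_reals all_analysis.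

Set Implicit Arguments.
Unset Strict Implicit.
Unset Printing Implicit Defensive.

Import Order.TTheory GRing.Theory Num.Theory.
Import numFieldNormedType.Exports.

Local Open Scope classical_set_scope.
Local Open Scope ring_scope.

(* The library's norm `|x| and its balls on 'rV[R]_d are those of the sup norm,
   hence the Euclidean norm is defined here.  Both norms induce the library's
   topology on 'rV[R]_d, the one in which interiors are taken below. *)
Definition enorm (R : realType) (d : nat) (x : 'rV[R]_d) : R :=
  Num.sqrt (\sum_(i < d) x 0 i ^+ 2).

Definition eball (R : realType) (d : nat) (c : 'rV[R]_d) (r : R) :
    set 'rV[R]_d :=
  [set x | enorm (x - c) <= r].

(* The notion is meant for d > 0 and positive radii: eball c r is empty for
   r < 0, and in dimension 0 every ball of radius r >= 0 is the whole space. *)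
Definition packs (R : realType) (d k : nat) (a : 'I_k -> R) (r : R) : Prop :=
  exists (o : 'rV[R]_d) (c : 'I_k -> 'rV[R]_d),
    (forall i, eball (c i) (a i) `<=` eball o r) /\
    (forall i j, i != j ->
       interior (eball (c i) (a i)) `&` interior (eball (c j) (a j)) = set0).

Arguments packs {R} d {k} a r.

(* Main.v *)
Require Import Defs.
From mathcomp Require Import all_boot all_order all_algebra.
From mathcomp Require Import all_classical all_reals all_analysis.
From mathcomp Require Import ring lra.

Import Order.TTheory GRing.Theory Num.Theory.
Import numFieldNormedType.Exports.

Local Open Scope ring_scope.

(** Being a packing is a metric property of the centres: since the radii are
positive and the dimension is positive, ball i lies in the container exactly
when |c_i - o| + a_i <= r, and two balls have disjoint interiors exactly when
|c_i - c_j| >= a_i + a_j ([packsP]).  Hence a linear map that does not increase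
norms and preserves the distances between the centres carries a packing to a
packing of the same radius, in whatever dimension it lands
([packs_linear]).

From dimension k - 1 to d such a map is the inclusion of coordinates.  From d
to k - 1, the k centres lie in an affine subspace of dimension at most k - 1,
directed by the k - 1 vectors c_i - c_0.  The Gram-Schmidt process
([gram_schmidt]) gives a d x (k - 1) matrix Q such that Q Q^T is the orthogonal
projector onto their span, and x |-> x Q is the required map: it only shortens
the vectors c_i - o, because the container's centre is in effect projected
onto the affine span of the centres, and it is isometric on the differences
c_i - c_j, which lie in that span.

For a single ball the criterion is |c - o| + a <= r, which can be met if and
only if it is met with c = o. *)

(** * Euclidean norm *)

Definition dot {R : realType} {d : nat} (x y : 'rV[R]_d) : R := (x *m y^T) 0 0.

Section EuclideanNorm.
Context {R : realType} {d : nat}.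
Implicit Types (x y z u c : 'rV[R]_d) (t a r : R).

Lemma dotC x y : dot x y = dot y x.
Proof. by rewrite /dot !mxE; apply: eq_bigr => i _; rewrite !mxE mulrC. Qed.

Lemma dotDl x y z : dot (x + y) z = dot x z + dot y z.
Proof. by rewrite /dot mulmxDl mxE. Qed.

Lemma dotZl t x y : dot (t *: x) y = t * dot x y.
Proof. by rewrite /dot -scalemxAl mxE. Qed.

Lemma dotDr x y z : dot z (x + y) = dot z x + dot z y.
Proof. by rewrite dotC dotDl !(dotC _ z). Qed.

Lemma dotZr t x y : dot x (t *: y) = t * dot x y.
Proof. by rewrite dotC dotZl dotC. Qed.

Lemma dotxxE x : dot x x = \sum_(i < d) x 0 i ^+ 2.
Proof. by rewrite /dot mxE; apply: eq_bigr => i _; rewrite mxE expr2. Qed.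

Lemma dotxx_ge0 x : 0 <= dot x x.
Proof. by rewrite dotxxE sumr_ge0 // => i _; rewrite sqr_ge0. Qed.

Lemma enormE x : enorm x = Num.sqrt (dot x x).
Proof. by rewrite dotxxE. Qed.

Lemma enorm_ge0 x : 0 <= enorm x.
Proof. exact: sqrtr_ge0. Qed.

Lemma enorm_sqr x : enorm x ^+ 2 = dot x x.
Proof. by rewrite enormE sqr_sqrtr // dotxx_ge0. Qed.

Lemma enorm0_eq0 x : enorm x = 0 -> x = 0.
Proof.
move=> x0; have /eqP : \sum_(i < d) x 0 i ^+ 2 = 0.
  by rewrite -dotxxE -enorm_sqr x0 expr0n.
rewrite psumr_eq0 => [/allP s0|i _]; last exact: sqr_ge0.
by apply/rowP => i; have /(_ (mem_index_enum i)) := s0 i;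
  rewrite /= sqrf_eq0 mxE => /eqP.
Qed.

Lemma enormZ t x : enorm (t *: x) = `|t| * enorm x.
Proof.
by rewrite !enormE dotZl dotZr mulrA -expr2 sqrtrM ?sqr_ge0// sqrtr_sqr.
Qed.

Lemma enormN x : enorm (- x) = enorm x.
Proof. by rewrite -scaleN1r enormZ normrN1 mul1r. Qed.

Lemma enorm_distC x y : enorm (x - y) = enorm (y - x).
Proof. by rewrite -opprB enormN. Qed.

Lemma enorm0 : enorm (0 : 'rV[R]_d) = 0.
Proof. by rewrite -(scale0r 0) enormZ normr0 mul0r. Qed.

(** Expand the square of |y| x - |x| y. *)
Lemma cauchy_schwarz x y : dot x y <= enorm x * enorm y.
Proof.
have [/enorm0_eq0 ->|x0] := eqVneq (enorm x) 0.
  by rewrite enorm0 mul0r -(scale0r 0) dotZl mul0r.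
have [/enorm0_eq0 ->|y0] := eqVneq (enorm y) 0.
  by rewrite enorm0 mulr0 -(scale0r 0) dotZr mul0r.
have xy_gt0 : 0 < enorm x * enorm y.
  by rewrite mulr_gt0 // lt_neqAle enorm_ge0 eq_sym ?x0 ?y0.
have := dotxx_ge0 (enorm y *: x + (- enorm x) *: y).
rewrite !(dotDl, dotDr, dotZl, dotZr) -!enorm_sqr (dotC y x) => h.
rewrite -subr_ge0 -(pmulr_rge0 _ xy_gt0).
by nra.
Qed.

Lemma enormD x y : enorm (x + y) <= enorm x + enorm y.
Proof.
rewrite -(@ler_pXn2r _ 2) ?nnegrE ?addr_ge0 ?enorm_ge0 //.
rewrite enorm_sqr !(dotDl, dotDr) -!enorm_sqr (dotC y x).
have := cauchy_schwarz x y; by lra.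
Qed.

Lemma enorm_triangle x y z : enorm (x - z) <= enorm (x - y) + enorm (y - z).
Proof. by apply: le_trans (enormD _ _); rewrite addrA subrK. Qed.

(** When x = 0 any unit vector serves, and there is one because the dimension is
positive. *)
Lemma unit_direction x : (0 < d)%N ->
  exists2 u, enorm u = 1 & x = enorm x *: u.
Proof.
move=> d_gt0; have [x0|x0] := eqVneq (enorm x) 0; last first.
  exists ((enorm x)^-1 *: x); last by rewrite scalerA divff // scale1r.
  by rewrite enormZ ger0_norm ?invr_ge0 ?enorm_ge0 // mulVf.
exists (delta_mx 0 (Ordinal d_gt0)); last by rewrite x0 scale0r (enorm0_eq0 x).
by rewrite enormE /dot trmx_delta mul_delta_mx mxE !eqxx sqrtr1.
Qed.

(** Moving outwards along the direction of x makes the triangle inequality an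
equality; this produces the extreme points of balls. *)
Lemma enorm_addZ x : (0 < d)%N ->
  exists2 u, enorm u = 1 & forall t, 0 <= t -> enorm (x + t *: u) = enorm x + t.
Proof.
move=> /(unit_direction x)[u u1 xu]; exists u => // t t0.
by rewrite [in LHS]xu -scalerDl enormZ u1 mulr1 ger0_norm // addr_ge0 ?enorm_ge0.
Qed.

Lemma enorm_dist_continuous c : continuous (fun x => enorm (x - c)).
Proof.
move=> x; rewrite /enorm.
apply: (@continuous_comp _ _ _
  (fun x : 'rV[R]_d => \sum_(i < d) (x - c) 0 i ^+ 2) Num.sqrt);
  last exact: sqrt_continuous.
apply: (@continuous_big R 'I_d +%R 0) => [|i _ {}x]; first exact: add_continuous.
under eq_fun do rewrite !mxE.
apply: (@continuous_comp _ _ _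
  (fun x : 'rV[R]_d => x 0 i) (fun t : R => (t - c 0 i) ^+ 2)).
  exact: coord_continuous.
apply: (@continuous_comp _ _ _ (fun t : R => t - c 0 i) (fun t : R => t ^+ 2)).
  by apply: cvgB => //; exact: cvg_cst.
exact: exprn_continuous.
Qed.

End EuclideanNorm.

(** * Balls and the metric form of packing *)

Section Balls.
Context {R : realType} {d : nat} (d_gt0 : (0 < d)%N).
Implicit Types (x c o : 'rV[R]_d) (a b r : R).
Local Open Scope classical_set_scope.

(** The point of the inner ball that is farthest from o lies on the ray from o
through c. *)
Lemma sub_eball c o a r : 0 <= a ->
  (eball c a `<=` eball o r) <-> enorm (c - o) + a <= r.
Proof.
move=> a0; split=> [sub|le x xc]; last first.
  by apply: le_trans (enorm_triangle x c o) _; move: xc le; rewrite /eball /=; lra.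
have [u u1 uE] := enorm_addZ (c - o) d_gt0.
have := sub (c + a *: u).
rewrite /eball /= addrAC subrr add0r enormZ u1 mulr1 ger0_norm // lexx.
by rewrite addrAC uE //; apply.
Qed.

(** A point of the interior stays in the ball when pushed a little away from c,
so it cannot be on the bounding sphere; conversely the open ball is open because
the norm is continuous. *)
Lemma interior_eball c a :
  interior (eball c a) = [set x | enorm (x - c) < a].
Proof.
apply/seteqP; split=> x /=; last first.
  move=> xc; apply: (@filterS _ _ _ [set y | enorm (y - c) < a]).
    by move=> y /=; rewrite /eball /= => /ltW.
  exact: cvgr_lt (enorm_dist_continuous c x) _ xc.
move=> xint.
have [u u1 uE] := enorm_addZ (x - c) d_gt0.
have cont : (fun t : R => x + t *: u) t @[t --> (0 : R)] --> x.
  suff: (fun t : R => x + t *: u) t @[t --> (0 : R)] --> x + 0 *: u.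
    by rewrite scale0r addr0.
  apply: (@cvgD R 'rV[R]_d); first exact: cvg_cst.
  exact: cvgZr_tmp.
have /cont/nbhs_ballP[e /= e0 /(_ (e / 2))] := xint.
rewrite /ball /= sub0r normrN ger0_norm; last by lra.
move=> /(_ ltac:(lra)); rewrite /eball /= addrAC uE; lra.
Qed.

(** If the centres are too close, the point dividing the segment from c to c' in
the ratio a : b is in both interiors. *)
Lemma disjoint_interior_eball c c' a b : 0 < a -> 0 < b ->
  (interior (eball c a) `&` interior (eball c' b) = set0) <->
  a + b <= enorm (c - c').
Proof.
move=> a0 b0; rewrite !interior_eball; split=> [dis|le]; last first.
  rewrite -subset0 => x /= [xc xc'].
  have := enorm_triangle c x c'; rewrite (enorm_distC c x); lra.
rewrite leNgt; apply/negP => lt.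
have ab0 : 0 < a + b by lra.
have abN0 : a + b != 0 by rewrite gt_eqF.
suff : set0 (c + (a / (a + b)) *: (c' - c)) by [].
rewrite -dis; split=> /=.
  rewrite addrAC subrr add0r enormZ ger0_norm ?divr_ge0 ?ltW //.
  by rewrite enorm_distC mulrAC ltr_pdivrMr // ltr_pM2l.
have -> : c + (a / (a + b)) *: (c' - c) - c' = (b / (a + b)) *: (c - c').
  by apply/rowP => i; rewrite !mxE; field.
rewrite enormZ ger0_norm ?divr_ge0 ?ltW //.
by rewrite mulrAC ltr_pdivrMr // ltr_pM2l.
Qed.

Lemma packsP k (a : 'I_k -> R) r : (forall i, 0 < a i) ->
  packs d a r <->
  exists (o : 'rV[R]_d) (c : 'I_k -> 'rV[R]_d),
    (forall i, enorm (c i - o) + a i <= r) /\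
    (forall i j, i != j -> a i + a j <= enorm (c i - c j)).
Proof.
move=> a0; split=> -[] o [c [sub dis]]; exists o, c; split=> [i|i j ij].
- by apply/(sub_eball _ _ _ _ (ltW (a0 i))).
- by apply/disjoint_interior_eball => //; apply: dis.
- by apply/(sub_eball _ _ _ _ (ltW (a0 i))).
- by apply/disjoint_interior_eball => //; apply: dis.
Qed.

End Balls.

(** * Moving a packing by a linear map *)

Lemma packs_linear {R : realType} {m n k : nat} {a : 'I_k -> R} {r : R}
    (o : 'rV[R]_m) (c : 'I_k -> 'rV[R]_m) (Q : 'M[R]_(m, n)) :
    (0 < n)%N -> (forall i, 0 < a i) ->
    (forall x, enorm (x *m Q) <= enorm x) ->
    (forall i j, enorm ((c i - c j) *m Q) = enorm (c i - c j)) ->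
    (forall i, enorm (c i - o) + a i <= r) ->
    (forall i j, i != j -> a i + a j <= enorm (c i - c j)) ->
  packs n a r.
Proof.
move=> n_gt0 a0 contr isom sub dis; apply/packsP => //.
exists (o *m Q), (fun i => c i *m Q); split=> [i|i j ij].
  by apply: le_trans (sub i); rewrite lerD2r -mulmxBl.
by rewrite -mulmxBl isom dis.
Qed.

Section Compression.
Context {R : realType} {d : nat}.

Lemma dot_mulmx {n} (x y : 'rV[R]_d) (Q : 'M[R]_(d, n)) :
  dot (x *m Q) (y *m Q) = dot (x *m (Q *m Q^T)) y.
Proof. by rewrite /dot trmx_mul !mulmxA. Qed.

Lemma enorm_mulmx_fixed {n} (Q : 'M[R]_(d, n)) (x : 'rV[R]_d) :
  x *m (Q *m Q^T) = x -> enorm (x *m Q) = enorm x.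
Proof. by move=> fx; rewrite !enormE dot_mulmx fx. Qed.

(** A symmetric idempotent Q Q^T is an orthogonal projector E, and |x Q|^2 =
x.(x E), so the claim is that |x|^2 - x.(x E) = |x - x E|^2 is nonnegative. *)
Lemma enorm_mulmx_le {n} (Q : 'M[R]_(d, n)) (x : 'rV[R]_d) :
  (Q *m Q^T) *m (Q *m Q^T) = Q *m Q^T -> enorm (x *m Q) <= enorm x.
Proof.
set E := Q *m Q^T => idem.
have Esym : E^T = E by rewrite trmx_mul trmxK.
have xEE : dot (x *m E) (x *m E) = dot (x *m E) x.
  by rewrite dot_mulmx Esym idem.
rewrite !enormE dot_mulmx -/E ler_sqrt ?dotxx_ge0 //.
have := dotxx_ge0 (x + (-1) *: (x *m E)).
rewrite !(dotDl, dotDr, dotZl, dotZr) xEE (dotC x); lra.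
Qed.

(** Orthonormalization in a form that needs no discussion of linear dependence:
a vector v already fixed by the projector E = Q Q^T of the others contributes
the zero column, which is what normalizing w = v - v E = 0 yields, as the
inverse of 0 is 0.  The property of u that makes both cases alike is
u (u^T u) = u. *)
Lemma gram_schmidt n (A : 'M[R]_(n, d)) :
  exists Q : 'M[R]_(d, n),
    (Q *m Q^T) *m (Q *m Q^T) = Q *m Q^T /\ A *m (Q *m Q^T) = A.
Proof.
elim: n A => [A|n IH].
  by exists 0; rewrite !mul0mx; split=> //; apply/matrixP => -[].
change n.+1 with (1 + n)%N => A; rewrite -(vsubmxK A).
set v := usubmx _; set B := dsubmx _.
have [Q [idem fB]] := IH B; move EE : (Q *m Q^T) idem fB => E idem fB.
pose w := v - v *m E; pose u := (enorm w)^-1 *: w.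
have Esym : E^T = E by rewrite -EE trmx_mul trmxK.
have wE : w *m E = 0 by rewrite mulmxBl -mulmxA idem subrr.
have uE : u *m E = 0 by rewrite -scalemxAl wE scaler0.
have Eu : E *m u^T = 0 by rewrite -Esym -trmx_mul uE trmx0.
have wuu : w *m (u^T *m u) = w.
  have [w0|w0] := eqVneq (enorm w) 0; first by rewrite (enorm0_eq0 _ w0) mul0mx.
  have ww : w *m w^T = (enorm w ^+ 2)%:M by rewrite [LHS]mx11_scalar enorm_sqr.
  rewrite mulmxA /u -scalemxAr [(_ *: w)^T]linearZ /= -scalemxAr -scalemxAl.
  rewrite ww mul_scalar_mx.
  by rewrite !scalerA -expr2 exprVn mulVf ?scale1r ?sqrf_eq0.
have uuu : u *m (u^T *m u) = u by rewrite {1}/u -scalemxAl wuu.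
exists (row_mx u^T Q).
rewrite tr_row_mx mul_row_col trmxK EE; split.
  rewrite mulmxDl !mulmxDr idem -!mulmxA uE mulmx0 uuu addr0.
  by rewrite [E *m _]mulmxA Eu mul0mx add0r.
rewrite mul_col_mx !mulmxDr fB -{2}fB.
have -> : B *m (u^T *m u) = 0 by rewrite -fB -mulmxA (mulmxA E) Eu mul0mx mulmx0.
have vE : v = w + v *m E by rewrite subrK.
have -> : v *m (u^T *m u) = w.
  by rewrite [in LHS]vE mulmxDl wuu -mulmxA (mulmxA E) Eu mul0mx mulmx0 addr0.
by rewrite -vE fB add0r.
Qed.

End Compression.

Theorem lemma32 (R : realType) :
  (forall (k d : nat) (a : 'I_k -> R) (r : R),
     (2 <= k)%N -> (k - 1 <= d)%N -> (forall i, 0 < a i) ->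
     (packs d a r <-> packs (k - 1) a r)) /\
  (forall (d : nat) (a r : R),
     (0 < d)%N -> 0 < a ->
     (packs d (fun _ : 'I_1 => a) r <-> a <= r)).
Proof.
split=> [[//|k] d a r k2 kd a0|d a r d_gt0 a0]; last first.
  split=> [/packsP[] // o [c [/(_ 0) le _]]|le].
    by have := enorm_ge0 (c 0 - o); lra.
  apply/packsP => //; exists 0, (fun=> 0); split=> [i|i j].
    by rewrite subrr enorm0 add0r.
  by rewrite !ord1.
move: kd; rewrite subn1 /= => kd.
have k_gt0 : (0 < k)%N by [].
have d_gt0 : (0 < d)%N by apply: leq_trans kd.
split=> /packsP[] // o [c [sub dis]].
  (* The k - 1 differences with the first centre span all the others. *)
  have [Q [idem fA]] := gram_schmidt _ (\matrix_(i < k) (c (lift ord0 i) - c ord0)).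
  have fix0 i : (c i - c ord0) *m (Q *m Q^T) = c i - c ord0.
    case: (unliftP ord0 i) => [j ->|->]; last by rewrite subrr mul0mx.
    by have := congr1 (row j) fA; rewrite row_mul rowK.
  apply: (packs_linear o c Q) => // [x|i j]; first exact: enorm_mulmx_le.
  apply: enorm_mulmx_fixed.
  by rewrite -(addrKA (- c ord0)) [- c ord0 + _]addrC mulmxBl !fix0.
have isom (x : 'rV[R]_k) : enorm (x *m (pid_mx k : 'M[R]_(k, d))) = enorm x.
  by apply: enorm_mulmx_fixed; rewrite tr_pid_mx pid_mx_id // pid_mx_1 mulmx1.
by apply: (packs_linear o c (pid_mx k)) => // x; rewrite isom.
Qed.
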